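(* Let $A$ be an artin algebra. If $X$ is a submodule of a finitely generated $A$-module $Y$, then $\operatorname{del} X\le \operatorname{pd} Y$.
   Context: Modules are left $A$-modules; $\operatorname{pd}$ denotes projective dimension (possibly $\infty$). For a finitely generated module $M$, $\Omega M$ is the kernel of a projective cover of $M$, $\Omega^0M=M$ and $\Omega^{d+1}M=\Omega(\Omega^dM)$. The delooping level $\operatorname{del} M$ is the smallest $d\ge 0$ such that $\Omega^d M$ is a direct summand of $P\oplus\Omega^{d+1}M'$ for some finitely generated modules $P, M'$ with $P$ projective ($\operatorname{del}M=\infty$ if no such $d$ exists). *)

(* Defs.v *)
From HB Require Import structures.
From mathcomp Require Import all_boot all_order all_algebra.
From mathcomp Require Import boolp constructive_ereal.

Set Implicit Arguments.
Unset Strict Implicit.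
Unset Printing Implicit Defensive.

Import Order.TTheory GRing.Theory Num.Theory.
Local Open Scope ring_scope.

(* Rings are pzRingType rather than nzRingType (and algebras are given by a
   central structure morphism rather than by algType, which requires 1 != 0),
   so that the zero algebra is not excluded. *)

Definition surjective (S T : Type) (f : S -> T) : Prop :=
  forall y, exists x, f x = y.

Definition exact (R : pzRingType) (L M N : lmodType R)
    (f : {linear L -> M}) (g : {linear M -> N}) : Prop :=
  forall x, g x = 0 <-> exists y, f y = x.

Definition fin_gen (R : pzRingType) (M : lmodType R) : Prop :=
  exists (n : nat) (e : 'I_n -> M),
    forall x, exists c : 'I_n -> R, x = \sum_i c i *: e i.

Definition artinian_module (R : pzRingType) (M : lmodType R) : Prop :=
  forall S : nat -> submodClosed M,
    (forall n, {subset S n.+1 <= S n}) ->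
    exists n, forall m, (n <= m)%N -> S m =i S n.

(* The last clause says that A is finitely generated as a k-module, for the
   k-module structure c . a = phi c * a. *)
Definition artin_algebra (A : pzRingType) : Prop :=
  exists (k : comPzRingType) (phi : {rmorphism k -> A}),
    [/\ artinian_module k^o,
        forall c a, phi c * a = a * phi c &
        exists (n : nat) (e : 'I_n -> A),
          forall a, exists c : 'I_n -> k, a = \sum_i phi (c i) * e i].

Section Modules.
Variable A : pzRingType.
Implicit Types K L M N P : lmodType A.

Definition projective P : Prop :=
  forall M N (g : {linear M -> N}) (f : {linear P -> N}),
    surjective g -> exists h : {linear P -> M}, forall x, g (h x) = f x.

Definition direct_summand N L : Prop :=
  exists (C : lmodType A) (f : {linear (N * C)%type -> L}), bijective f.

(* Superfluous kernel: the only submodule S of P with S + ker f = P is P. *)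
Definition projective_cover P M (f : {linear P -> M}) : Prop :=
  [/\ projective P, surjective f &
      forall S : submodClosed P,
        (forall x, exists2 y, y \in S & exists2 z, f z = 0 & x = y + z) ->
        forall x, x \in S].

(* K is isomorphic to the kernel of a projective cover of M.  Since Omega M is
   only defined up to isomorphism (and only when M has a projective cover),
   it is rendered as a relation. *)
Definition is_Omega M K : Prop :=
  exists P (f : {linear P -> M}) (i : {linear K -> P}),
    [/\ projective_cover f, injective i & exact i f].

Inductive is_Omega_iter M : nat -> lmodType A -> Prop :=
| is_Omega_iter0 : is_Omega_iter M 0 M
| is_Omega_iterS d L K :
    is_Omega_iter M d L -> is_Omega L K -> is_Omega_iter M d.+1 K.

Definition del_cond M (d : nat) : Prop :=
  exists K P M' K',
    [/\ is_Omega_iter M d K,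
        fin_gen P /\ projective P,
        fin_gen M',
        is_Omega_iter M' d.+1 K' &
        direct_summand K (P * K')%type].

(* 0 -> P_n -> ... -> P_0 -> M -> 0 exact with all P_i projective, as a
   resolution indexed by nat that vanishes beyond n. *)
Definition has_proj_resolution M (n : nat) : Prop :=
  exists (P : nat -> lmodType A) (d : forall i, {linear P i.+1 -> P i})
         (e : {linear P 0 -> M}),
    [/\ forall i, projective (P i),
        surjective e,
        exact (d 0) e,
        forall i, exact (d i.+1) (d i) &
        forall i, (n < i)%N -> forall x : P i, x = 0].

End Modules.

(* The least natural number satisfying Q, and +oo if there is none; the values
   0, 1, 2, ..., +oo are taken in \bar int so as to use its order. *)
Definition least (Q : nat -> Prop) : \bar int :=
  if pselect (exists n, `[< Q n >]) is left h
  then (Posz (ex_minn h))%:E else +oo%E.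

Definition del (A : pzRingType) (M : lmodType A) : \bar int :=
  least (del_cond M).

Definition pd (A : pzRingType) (M : lmodType A) : \bar int :=
  least (has_proj_resolution M).

(* Main.v *)
Require Import Defs.
From HB Require Import structures.
From mathcomp Require Import all_boot all_order all_algebra.
From mathcomp Require Import boolp classical_sets constructive_ereal.

(** Why the statement holds. Let [pd Y = n] be finite and put [Z = Y / X], so
that [0 -> X -> Y -> Z -> 0] is exact. For [n = 0] the module [Y] is
projective; comparing [0 -> X -> Y -> Z -> 0] with a projective cover [0 ->
Omega Z -> Q -> Z -> 0], Schanuel's lemma ([schanuel]) gives [X + Q ~ Y +
Omega Z], so that [X] is a summand of [Y + Omega Z] and [del X = 0]. For [n >
0], the horseshoe lemma ([horseshoe]) applied to projective covers of [X] and
[Z] yields an exact sequence [0 -> Omega X -> W -> Omega Z -> 0], where [W] is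
the kernel of a surjection from a projective module onto [Y]; hence [pd W <= n
- 1] ([pd_le_syzygy]), and induction on [n] ([Omega_iter_summand]) makes
[Omega^n X] a summand of [P + Omega^(n+1) Z] with [P] projective and finitely
generated. Hence [del X <= n], with [Z] as the witness [M'].

That all modules of the induction are finitely generated and have projective
covers rests on two facts about a finitely generated module [M] over an artin
algebra: its submodules satisfy the descending chain condition and are
finitely generated ([artin_algebra_fin_gen]). Both are inherited from the
commutative artinian base ring [k], over which [M] is finitely generated. The
descending condition passes to finitely generated modules by induction on the
number of generators ([dcc_span]). Finite generation is the theorem that an
artinian module over a commutative artinian ring is noetherian
([comm_artinian_noetherian]), proved here without the Jacobson radical: a
minimal submodule [S] among those that are not finitely generated is either
divisible by or killed by each scalar, so that it is a vector space over a
residue field of [k], all of whose proper subspaces have finite dimension,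
which is absurd.

Projective covers come from the same two facts ([projective_cover_exists]):
among the endomorphisms of a free module [F] over a given surjection [F -> M],
one with a minimal image has a projective image, and this image covers [M]. *)

Set Implicit Arguments.
Unset Strict Implicit.
Unset Printing Implicit Defensive.

Import Order.TTheory GRing.Theory Num.Theory.
Local Open Scope ring_scope.

(** * Linear maps *)

Lemma linear_of (R : pzRingType) (M N : lmodType R) (f : M -> N) :
  linear f -> exists g : {linear M -> N}, g =1 f.
Proof.
move=> fL.
pose fM := GRing.isLinear.Build R M N _ f fL.
by exists (HB.pack f fM : {linear M -> N}).
Qed.

Lemma pair_ext (S T : Type) (u v : S * T) : u.1 = v.1 -> u.2 = v.2 -> u = v.
Proof. by case: u v => [x y] [x' y'] /= -> ->. Qed.

Lemma linear_inl (R : pzRingType) (M N : lmodType R) :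
  exists f : {linear M -> (M * N)%type}, f =1 fun x => (x, 0).
Proof.
by apply: linear_of => a x y; apply: pair_ext; rewrite /= ?scaler0 ?addr0.
Qed.

(** * Submodules and quotients *)

(** Submodules are handled as [Prop]-valued predicates, so that they can be
defined by existential statements; the lemmas below turn them into modules. *)
Definition submodule (R : pzRingType) (M : lmodType R) (S : M -> Prop) :=
  S 0 /\ forall a x y, S x -> S y -> S (a *: x + y).

Lemma submodClosed_of (R : pzRingType) (M : lmodType R) (S : M -> Prop) :
  submodule S -> exists S' : submodClosed M, forall x, x \in S' <-> S x.
Proof.
case=> S0 SL; pose S' : {pred M} := fun x => `[< S x >].
have cl : GRing.submod_closed S'.
  split; first exact/asboolP.
  by move=> a x y /asboolP Sx /asboolP Sy; apply/asboolP; apply: SL.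
pose SM := GRing.isSubmodClosed.Build R M S' cl.
exists (HB.pack S' SM : submodClosed M) => x; split=> [/asboolP//|Sx].
exact/asboolP.
Qed.

Section Carrier.
Variables (R : pzRingType) (M : lmodType R) (S : submodClosed M).
Definition carrier : Type := {x : M | x \in S}.
HB.instance Definition _ := SubChoice.on carrier.
HB.instance Definition _ := [SubChoice_isSubLmodule of carrier by <:].
HB.instance Definition _ := GRing.Linear.on (\val : carrier -> M).
End Carrier.

Lemma submodule_incl (R : pzRingType) (M : lmodType R) (S : M -> Prop) :
  submodule S ->
  exists (L : lmodType R) (i : {linear L -> M}),
    injective i /\ forall x, S x <-> exists y, i y = x.
Proof.
case/submodClosed_of=> S' S'P.
exists (carrier S' : lmodType R), (\val : carrier S' -> M); split.
  exact: val_inj.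
move=> x; split=> [/S'P Sx|[y <-]]; last by apply/S'P; exact: valP.
by exists (exist _ x Sx : carrier S').
Qed.

Section Cokernel.
Local Open Scope quotient_scope.

Lemma cokernel (R : pzRingType) (M : lmodType R) (S : M -> Prop) :
  submodule S ->
  exists (Z : lmodType R) (p : {linear M -> Z}),
    surjective p /\ forall x, p x = 0 <-> S x.
Proof.
case=> S0 SL.
have SB x y : S x -> S y -> S (x - y).
  by move=> Sx Sy; rewrite addrC -scaleN1r; apply: SL.
have SZ a x : S x -> S (a *: x) by move=> Sx; rewrite -[_ *: _]addr0; apply: SL.
pose S' : {pred M} := fun x => `[< S x >].
have cl : zmod_closed S'.
  split; first exact/asboolP.
  by move=> x y /asboolP Sx /asboolP Sy; apply/asboolP; apply: SB.
pose I : zmodClosed M := HB.pack S' (GRing.isZmodClosed.Build M S' cl).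
pose Q := Quotient.quot I.
have IE x : (x \in I) <-> S x by split=> [/asboolP|Sx] //; apply/asboolP.
have piP x y : \pi_Q x = \pi_Q y <-> S (x - y).
  by rewrite -IE Quotient.idealrBE; split=> /eqP.
have piB : {morph \pi_Q : x y / x + y} by move=> x y; rewrite !piE.
have [sc scE] : exists sc : R -> Q -> Q, forall a x,
    sc a (\pi_Q x) = \pi_Q (a *: x).
  exists (fun a q => \pi_Q (a *: repr q)) => a x.
  by apply/piP; rewrite -scalerBr; apply: SZ; apply/piP; rewrite reprK.
have scA a b q : sc a (sc b q) = sc (a * b) q.
  by rewrite -[q]reprK !scE scalerA.
have sc1 : left_id 1 sc by move=> q; rewrite -[q]reprK !scE scale1r.
have scDr : right_distributive sc +%R.
  by move=> a q r; rewrite -[q]reprK -[r]reprK -piB !scE scalerDr piB.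
have scDl q : {morph sc^~ q : a b / a + b}.
  by move=> a b; rewrite -[q]reprK !scE scalerDl piB.
pose Z : lmodType R :=
  HB.pack Q (GRing.Zmodule_isLmodule.Build R Q scA sc1 scDr scDl).
have piL : linear (\pi_Q : M -> Z).
  by move=> a x y; rewrite piB -scE.
case: (linear_of piL) => p pE; exists Z, p; split.
  by move=> z; exists (repr (z : Q)); rewrite pE reprK.
move=> x; rewrite pE; have -> : (0 : Z) = \pi_Q 0 by rewrite piE.
by rewrite piP subr0.
Qed.

End Cokernel.

Section SubmoduleTheory.
Variables (R : pzRingType) (M : lmodType R) (S : M -> Prop).
Hypothesis S_sub : submodule S.

Lemma submodule0 : S 0. Proof. by case: S_sub. Qed.

Lemma submoduleD x y : S x -> S y -> S (x + y).
Proof. by case: S_sub => _ SL Sx Sy; rewrite -[x]scale1r; apply: SL. Qed.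

Lemma submoduleZ a x : S x -> S (a *: x).
Proof. by case: S_sub => S0 SL Sx; rewrite -[_ *: _]addr0; apply: SL. Qed.

Lemma submoduleB x y : S x -> S y -> S (x - y).
Proof.
by move=> Sx Sy; rewrite -scaleN1r; apply: submoduleD => //; apply: submoduleZ.
Qed.

End SubmoduleTheory.

Section SubmodulesAndLinearMaps.
Variables (R : pzRingType) (M N : lmodType R) (f : {linear M -> N}).

Lemma submodule_image (S : M -> Prop) :
  submodule S -> submodule (fun y => exists2 x, S x & f x = y).
Proof.
move=> Ssub; split=> [|a _ _ [x Sx <-] [y Sy <-]].
  by exists 0; [exact: submodule0 | rewrite linear0].
by exists (a *: x + y); [case: Ssub => _; apply | rewrite linearP].
Qed.

Lemma submodule_range : submodule (fun y => exists x, f x = y).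
Proof.
split=> [|a _ _ [x <-] [y <-]]; first by exists 0; rewrite linear0.
by exists (a *: x + y); rewrite linearP.
Qed.

Lemma submodule_meet_kernel (S : M -> Prop) :
  submodule S -> submodule (fun x => S x /\ f x = 0).
Proof.
move=> Ssub; split=> [|a x y [Sx fx] [Sy fy]].
  by split; [exact: submodule0 | rewrite linear0].
by rewrite linearP fx fy scaler0 addr0; split=> //; case: Ssub => _; apply.
Qed.

End SubmodulesAndLinearMaps.

(** * Chain conditions *)

(** The smallest submodule containing [s], by quantification over submodules
rather than by linear combinations: membership proofs then need no sums. *)
Definition span (R : pzRingType) (M : lmodType R) (s : seq M) (x : M) :=
  forall T, submodule T -> (forall y, y \in s -> T y) -> T x.

Definition fin_spanned (R : pzRingType) (M : lmodType R) (S : M -> Prop) :=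
  exists s, forall x, S x <-> span s x.

Definition noetherian (R : pzRingType) (M : lmodType R) :=
  forall S : M -> Prop, submodule S -> fin_spanned S.

Definition dcc (R : pzRingType) (M : lmodType R) :=
  forall S : nat -> M -> Prop,
    (forall n, submodule (S n)) -> (forall n x, S n.+1 x -> S n x) ->
    exists n, forall m x, (n <= m)%N -> S n x -> S m x.

Section Span.
Variables (R : pzRingType) (M : lmodType R).
Implicit Types (s : seq M) (S : M -> Prop).

Lemma span_submodule s : submodule (span s).
Proof.
split=> [|a x y sx sy] T Tsub Ts; first exact: submodule0.
by case: (Tsub) => _; apply; [apply: sx | apply: sy].
Qed.

Lemma mem_span s x : x \in s -> span s x.
Proof. by move=> sx T _; apply. Qed.

Lemma span_cons v s x :
  span (v :: s) x <-> exists c y, span s y /\ x = c *: v + y.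
Proof.
split.
  move/(_ (fun x => exists c y, span s y /\ x = c *: v + y)); apply; last first.
    move=> y; rewrite inE => /orP[/eqP->|sy].
      exists 1, 0; rewrite scale1r addr0; split=> //.
      exact: submodule0 (span_submodule s).
    by exists 0, y; rewrite scale0r add0r; split=> //; apply: mem_span.
  split=> [|a _ _ [c [y [sy ->]]] [d [z [sz ->]]]].
    exists 0, 0; rewrite scale0r addr0; split=> //.
    exact: submodule0 (span_submodule s).
  exists (a * c + d), (a *: y + z); split.
    by case: (span_submodule s) => _; apply.
  by rewrite scalerDr scalerA scalerDl addrACA.
case=> c [y [sy ->]] T Tsub Ts; apply: submoduleD => //.
  by apply: submoduleZ => //; apply: Ts; rewrite mem_head.
by apply: sy => // z sz; apply: Ts; rewrite inE sz orbT.
Qed.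

Lemma fin_genP : fin_gen M <-> fin_spanned (fun _ : M => True).
Proof.
split=> [[n [e eP]]|[s sP]].
  exists [seq e i | i <- enum 'I_n] => x; split=> // _.
  have [c ->] := eP x; apply: big_ind => [|u v su sv|i _].
  - exact: submodule0 (span_submodule _).
  - exact: submoduleD (span_submodule _) _ _ su sv.
  - apply: submoduleZ (span_submodule _) _ _ _; apply: mem_span.
    by apply: map_f; rewrite mem_enum.
exists (size s), (fun i : 'I_(size s) => s`_i) => x.
have /sP/(_ (fun x => exists c : 'I_(size s) -> R, x = \sum_i c i *: s`_i)) :
  True by [].
apply.
  split=> [|a _ _ [c ->] [d ->]].
    by exists (fun=> 0); rewrite big1 // => i _; rewrite scale0r.
  exists (fun i => a * c i + d i); rewrite scaler_sumr -big_split /=.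
  by apply: eq_bigr => i _; rewrite scalerA scalerDl.
move=> y sy; have lt_y : (index y s < size s)%N by rewrite index_mem.
exists (fun i => (i == Ordinal lt_y)%:R).
rewrite (bigD1 (Ordinal lt_y)) //= eqxx scale1r nth_index // big1 ?addr0 //.
by move=> i /negPf->; rewrite scale0r.
Qed.

End Span.

(** Preimages of generators of [f S], together with generators of the kernel of
[f] on [S], generate [S]. *)
Lemma fin_spanned_extension (R : pzRingType) (M N : lmodType R)
    (f : {linear M -> N}) (S : M -> Prop) :
  submodule S ->
  fin_spanned (fun y => exists2 x, S x & f x = y) ->
  fin_spanned (fun x => S x /\ f x = 0) -> fin_spanned S.
Proof.
move=> Ssub [t tP] [s sP].
have /choice[g gP] (y : N) : exists x, y \in t -> S x /\ f x = y.
  have [ty|_] := boolP (y \in t); last by exists 0.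
  by have /tP[x Sx fx] := mem_span ty; exists x.
exists (map g t ++ s) => x; split=> [Sx T Tsub Tts|]; last first.
  apply=> // y; rewrite mem_cat => /orP[/mapP[z tz ->]|sy].
    by case: (gP _ tz).
  by have /sP[] := mem_span sy.
have [z [Tz Sz] fz] : exists2 z, T z /\ S z & f z = f x.
  have /tP : exists2 z, S z & f z = f x by exists x.
  move/(_ (fun y => exists2 z, T z /\ S z & f z = y)); apply.
    split=> [|a _ _ [y [Ty Sy] <-] [z [Tz Sz] <-]].
      by exists 0; [split; exact: submodule0 | rewrite linear0].
    exists (a *: y + z); last by rewrite linearP.
    by split; [case: Tsub => _; apply | case: Ssub => _; apply].
  move=> y ty; have [Sgy fgy] := gP _ ty; exists (g y) => //; split=> //.
  by apply: Tts; rewrite mem_cat map_f.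
rewrite -(subrK z x); apply: submoduleD => //.
have /sP : S (x - z) /\ f (x - z) = 0.
  by split; [exact: submoduleB | rewrite linearB fz subrr].
by apply=> // y sy; apply: Tts; rewrite mem_cat sy orbT.
Qed.

Lemma fin_spanned_zero (R : pzRingType) (M : lmodType R) (S : M -> Prop) :
  submodule S -> (forall x, S x -> x = 0) -> fin_spanned S.
Proof.
move=> Ssub S0; exists [::] => x; split; last by apply.
by move=> /S0-> T Tsub _; exact: submodule0.
Qed.

Lemma artinian_module_dcc (R : pzRingType) (M : lmodType R) :
  artinian_module M -> dcc M.
Proof.
move=> artM S Ssub Sdec.
have /choice[S' S'P] n : exists S' : submodClosed M,
    forall x, x \in S' <-> S n x.
  exact: submodClosed_of.
have [|n nP] := artM S'; first by move=> n x /S'P/Sdec/S'P.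
by exists n => m x le_nm /S'P; rewrite -(nP m le_nm) => /S'P.
Qed.

(** Without a minimal element, dependent choice would produce a strictly
descending chain in [Q]. *)
Lemma dcc_minimal (R : pzRingType) (M : lmodType R) (Q : (M -> Prop) -> Prop) :
  dcc M -> (forall S, Q S -> submodule S) -> (exists S, Q S) ->
  exists2 S, Q S & forall T, Q T -> (forall x, T x -> S x) ->
                             forall x, S x -> T x.
Proof.
move=> dccM Qsub [S0 QS0]; apply: contrapT => noMin.
have /choice[f fP] (S : {S | Q S}) : exists T : {S | Q S},
    (forall x, sval T x -> sval S x) /\ exists x, sval S x /\ ~ sval T x.
  case: S => S QS /=; apply: contrapT => noT; apply: noMin.
  exists S => // T QT TS x Sx.
  apply: contrapT => nTx; apply: noT; exists (exist _ T QT); split=> //.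
  by exists x.
pose C n := sval (iter n f (exist _ S0 QS0)).
have [||n nP] := dccM C.
- by move=> n; apply: Qsub; exact: svalP.
- by move=> n x; case: (fP (iter n f (exist _ S0 QS0))) => + _; apply.
case: (fP (iter n f (exist _ S0 QS0))) => _ [x [Sx]]; apply.
exact: (nP n.+1).
Qed.

(** Induction on the generators.  When [v] is added to [s], the traces of the
chain on the span of [s] stabilise by induction.  Two members of the chain with
the same trace there agree on the span of [v :: s] as soon as the same
coefficients of [v] occur in both, and these coefficients form a chain of
ideals. *)
Lemma dcc_span (R : pzRingType) (M : lmodType R) (s : seq M)
    (S : nat -> M -> Prop) :
  dcc R^o ->
  (forall n, submodule (S n)) -> (forall n x, S n.+1 x -> S n x) ->
  exists n, forall m x, (n <= m)%N -> span s x -> S n x -> S m x.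
Proof.
move=> dccR Ssub Sdec.
have Smono n m x : (n <= m)%N -> S m x -> S n x.
  elim: m => [|m IHm]; first by rewrite leqn0 => /eqP->.
  by rewrite leq_eqVlt ltnS => /orP[/eqP-> //|/IHm le_nm /Sdec].
elim: s => [|v s [n nP]].
  exists 0 => m x _ s0 _; suff -> : x = 0 by exact: submodule0.
  move: s0; move/(_ (fun x => x = 0)); apply=> //.
  by split=> // a _ _ -> ->; rewrite scaler0 add0r.
pose T n : R^o -> Prop := fun c : R => exists2 y, span s y & S n (c *: v + y).
have [|k c [y sy Sy]|k kP] := dccR T.
- move=> k; split=> [|a c d [y sy Sy] [z sz Sz]].
    exists 0; first exact: submodule0 (span_submodule s).
    by rewrite scale0r add0r; apply: submodule0.
  exists (a *: y + z); first by case: (span_submodule s) => _; apply.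
  rewrite scalerDl addrACA -scalerA -scalerDr.
  by case: (Ssub k) => _; apply.
- by exists y => //; apply: Sdec.
exists (maxn n k) => m x; rewrite geq_max => /andP[le_nm le_km].
move=> /span_cons[c [y [sy ->]]] Sx.
have [z sz Sz] : T m c.
  by apply: kP => //; exists y => //; apply: Smono Sx; exact: leq_maxr.
rewrite -(subrK (c *: v + z) (c *: v + y)); apply: submoduleD => //.
apply: nP => //.
  rewrite opprD addrACA subrr add0r.
  exact: submoduleB (span_submodule s) _ _ sy sz.
apply: submoduleB => //; first by apply: Smono Sx; exact: leq_maxl.
exact: Smono Sz.
Qed.

Lemma fin_spanned_dcc (R : pzRingType) (M : lmodType R) :
  dcc R^o -> fin_spanned (fun _ : M => True) -> dcc M.
Proof.
move=> dccR [s sP] S Ssub Sdec; have [n nP] := dcc_span s dccR Ssub Sdec.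
by exists n => m x le_nm; apply: nP => //; apply/sP.
Qed.

(** Zorn's lemma; for [v] outside the maximal [T], the submodule [R v + T] is
too large to avoid [s]. *)
Lemma submodule_maximal_avoiding (R : pzRingType) (M : lmodType R)
    (S : M -> Prop) (s : M) :
  submodule S -> s <> 0 ->
  exists T, [/\ submodule T, (forall x, T x -> S x), ~ T s &
    forall v, S v -> ~ T v -> exists a t, T t /\ s = a *: v + t].
Proof.
move=> Ssub s0.
(* Closure under linear combinations passes to unions of chains, even to the
   empty one; that 0 belongs to [T] then follows from maximality. *)
pose P (T : set M) := [/\ forall a x y, T x -> T y -> T (a *: x + y),
                          forall x, T x -> S x & ~ T s].
have [F FP Ftot|T [[TL TS nTs] Tmax]] := @Zorn_bigcup M P.
  split=> [a x y [A FA Ax] [B FB By]|x [A FA Ax]|[A FA As]].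
  - have [AB|BA] := Ftot _ _ FA FB.
      by exists B => //; have [+ _ _] := FP _ FB; apply=> //; apply: AB.
    by exists A => //; have [+ _ _] := FP _ FA; apply=> //; apply: BA.
  - by have [_ + _] := FP _ FA; apply.
  - by have [_ _] := FP _ FA; apply.
have T0 : T 0.
  apply: contrapT => nT0.
  have Te x : ~ T x.
    move=> Tx; apply: nT0; rewrite -(subrr x) addrC -scaleN1r; exact: TL.
  apply: (Tmax (fun x => x = 0)).
    by split=> [x Tx|/(_ 0 erefl)]; [case: (Te x Tx) | exact: Te].
  split=> [a _ _ -> ->|x ->|/s0//]; first by rewrite scaler0 addr0.
  exact: submodule0.
exists T; split=> // v Sv nTv.
apply: contrapT => noat.
apply: (Tmax (fun x => exists a t, T t /\ x = a *: v + t)).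
  split=> [x Tx|/(_ v) Tv]; first by exists 0, x; rewrite scale0r add0r.
  by apply: nTv; apply: Tv; exists 1, 0; rewrite scale1r addr0.
split=> [a _ _ [b [t [Tt ->]]] [c [u [Tu ->]]]|_ [a [t [Tt ->]]]|//].
  exists (a * b + c), (a *: t + u); split; first exact: TL.
  by rewrite scalerDr scalerA scalerDl addrACA.
by apply: submoduleD => //; [exact: submoduleZ | exact: TS].
Qed.

(** A minimal counterexample [S] is a vector space over a field: by minimality
each scalar [c] either kills [S] or maps it onto itself ([dichotomy]), since
otherwise both the image and the kernel of [c] on [S] would be finitely
generated; and in the second case [c] acts invertibly ([inverse]), because the
powers of [c] generate a stationary chain of ideals. A submodule of [S]
maximal among those avoiding some [s <> 0] is then a hyperplane with
complement [k s]; it is finitely generated by minimality, hence so is [S]. *)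
Lemma comm_artinian_noetherian (k : comPzRingType) (M : lmodType k) :
  dcc k^o -> dcc M -> noetherian M.
Proof.
move=> dcck dccM S0 S0sub; apply: contrapT => S0inf.
have [||S [Ssub Sinf] Smin] :=
  @dcc_minimal k M (fun S => submodule S /\ ~ fin_spanned S) dccM.
- by move=> S [].
- by exists S0.
have proper_fin T : submodule T -> (forall x, T x -> S x) ->
    ~ (forall x, S x -> T x) -> fin_spanned T.
  by move=> Tsub TS nST; apply: contrapT => Tinf; apply: nST; apply: Smin.
(* Commutativity makes the multiplication by [c] linear. *)
have dichotomy c : (forall x, S x -> exists2 y, S y & c *: y = x) \/
                   (forall x, S x -> c *: x = 0).
  apply: contrapT => /not_orP[nsurj nzero]; apply: Sinf.
  have [f fE] : exists f : {linear M -> M}, f =1 ( *:%R c).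
    by apply: linear_of => a x y; rewrite scalerDr !scalerA mulrC.
  apply: (fin_spanned_extension (f := f)) => //; apply: proper_fin.
  - exact: submodule_image.
  - by move=> _ [x Sx <-]; rewrite fE; apply: submoduleZ.
  - by move=> sub; apply: nsurj => x /sub[y Sy <-]; exists y; rewrite ?fE.
  - exact: submodule_meet_kernel.
  - by move=> x [].
  - by move=> sub; apply: nzero => x /sub[_]; rewrite fE.
have inverse c : ~ (forall x, S x -> c *: x = 0) ->
    exists d, forall x, S x -> d *: (c *: x) = x.
  move=> nzero; have [surj|//] := dichotomy c.
  have [||n nP] := dcck (fun n b => exists y : k, b = c ^+ n * y).
  - move=> n; split=> [|a _ _ [y ->] [z ->]]; first by exists 0; rewrite mulr0.
    by exists (a * y + z); rewrite mulrDr mulrCA.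
  - by move=> n _ [y ->]; exists (c * y); rewrite mulrA -exprSr.
  have [|y cny] := nP n.+1 (c ^+ n) (leqnSn n).
    by exists 1; rewrite mulr1.
  exists y => x Sx.
  have [z Sz <-] : exists2 z, S z & c ^+ n *: z = x.
    elim: n x Sx {nP cny} => [|n IHn] x Sx.
      by exists x; rewrite ?expr0 ?scale1r.
    have [x' Sx' <-] := surj x Sx; have [z Sz <-] := IHn _ Sx'.
    by exists z; rewrite // exprS scalerA.
  by rewrite !scalerA -mulrA -exprS mulrC -cny.
have [s Ss s0] : exists2 s, S s & s <> 0.
  apply: contrapT => S0'; apply: Sinf; apply: fin_spanned_zero => // x Sx.
  by apply: contrapT => x0; apply: S0'; exists x.
have [T [Tsub TS nTs Tmax]] := submodule_maximal_avoiding Ssub s0.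
have [|t tP] := proper_fin T Tsub TS; first by move/(_ s Ss).
apply: Sinf; exists (s :: t) => v; split; last first.
  apply=> // y; rewrite inE => /orP[/eqP->//|ty].
  by apply: TS; apply/tP; exact: mem_span.
move=> Sv; apply/span_cons.
have [/tP tv|nTv] := pselect (T v).
  by exists 0, v; rewrite scale0r add0r.
have [a [u [Tu sE]]] := Tmax v Sv nTv.
have [|d dP] := inverse a.
  by move=> a0; apply: nTs; rewrite sE a0 // add0r.
exists d, (- (d *: u)); split; first by
  rewrite -scaleNr; apply: (submoduleZ (span_submodule t)); apply/tP.
by rewrite sE scalerDr addrK dP.
Qed.

(** * Modules over artin algebras *)

(** A copy of the carrier of [M], mentioning [phi] so that its scalar action
can be inferred from the type. *)
Definition restriction (k A : pzRingType) (phi : {rmorphism k -> A})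
  (M : lmodType A) : Type := M.

Section RestrictionOfScalars.
Variables (k A : pzRingType) (phi : {rmorphism k -> A}) (M : lmodType A).

Local Notation restriction := (restriction phi M).
HB.instance Definition _ := GRing.Zmodule.on restriction.

Let scale (c : k) (x : restriction) : restriction := phi c *: (x : M).

Fact restriction_scalerA a b x : scale a (scale b x) = scale (a * b) x.
Proof. by rewrite /scale scalerA rmorphM. Qed.

Fact restriction_scale1r : left_id 1 scale.
Proof. by move=> x; rewrite /scale rmorph1 scale1r. Qed.

Fact restriction_scalerDr : right_distributive scale +%R.
Proof. by move=> a x y; rewrite /scale scalerDr. Qed.

Fact restriction_scalerDl x : {morph scale^~ x : a b / a + b}.
Proof. by move=> a b; rewrite /scale rmorphD scalerDl. Qed.

HB.instance Definition _ := GRing.Zmodule_isLmodule.Build k restriction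
  restriction_scalerA restriction_scale1r restriction_scalerDr
  restriction_scalerDl.

Lemma submodule_restriction (S : M -> Prop) :
  submodule S -> submodule (S : restriction -> Prop).
Proof. by case=> S0 SL; split=> // a x y; apply: SL. Qed.

Lemma restriction_dcc : dcc restriction -> dcc M.
Proof.
by move=> dccM S Ssub; apply: dccM => n; apply: submodule_restriction.
Qed.

Lemma restriction_noetherian : noetherian restriction -> noetherian M.
Proof.
move=> noethM S Ssub; have [s sP] := noethM S (submodule_restriction Ssub).
exists s => x; split=> [/sP sx T Tsub Ts|].
  by apply: sx => //; apply: submodule_restriction.
by apply=> // y sy; apply/sP; apply: mem_span.
Qed.

End RestrictionOfScalars.

(** Products of generators of [A] over [k] and of [M] over [A] generate [M] over
[k], and submodules over [A] are submodules over [k]. *)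
Lemma artin_algebra_fin_gen (A : pzRingType) (M : lmodType A) :
  artin_algebra A -> fin_gen M -> noetherian M /\ dcc M.
Proof.
case=> k [phi [/artinian_module_dcc dcck _ [n [e eP]]]] [m [g gP]].
have fsM : fin_spanned (fun _ : restriction phi M => True).
  exists [seq (e i *: g j : restriction phi M) |
           i <- enum 'I_n, j <- enum 'I_m].
  move=> x; split=> // _ T Tsub Ts; have [a ->] := gP x.
  apply: (big_ind T) => [|u v|j _]; first exact: (submodule0 Tsub).
    exact: (submoduleD Tsub).
  have [c ->] := eP (a j); rewrite scaler_suml.
  apply: (big_ind T) => [|u v|i _]; first exact: (submodule0 Tsub).
    exact: (submoduleD Tsub).
  rewrite -scalerA; apply: (submoduleZ Tsub (c i)); apply: Ts.
  by apply: allpairs_f; rewrite mem_enum.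
have dccM := fin_spanned_dcc dcck fsM; split.
  exact: restriction_noetherian (comm_artinian_noetherian dcck dccM).
exact: restriction_dcc dccM.
Qed.

(** * Kernels, isomorphisms and projective modules *)

Section LinearMaps.
Variable A : pzRingType.
Implicit Types K L M N P Q : lmodType A.

Lemma kernel M N (f : {linear M -> N}) :
  exists (K : lmodType A) (i : {linear K -> M}), injective i /\ exact i f.
Proof.
have [|K [i [i_inj iP]]] := @submodule_incl A M (fun x => f x = 0).
  split=> [|a x y fx fy]; first exact: linear0.
  by rewrite linearP fx fy scaler0 addr0.
by exists K, i.
Qed.

Lemma factor_through_injective L M N (i : {linear L -> M})
    (h : {linear N -> M}) :
  injective i -> (forall x, exists y, i y = h x) ->
  exists g : {linear N -> L}, forall x, i (g x) = h x.
Proof.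
move=> i_inj /choice[g gP].
have [|g' g'E] := @linear_of _ _ _ g.
  by move=> a x y; apply: i_inj; rewrite linearP !gP linearP.
by exists g' => x; rewrite g'E.
Qed.

Lemma factor_through_kernel K M N P (i : {linear K -> M}) (f : {linear M -> N})
    (h : {linear P -> M}) :
  injective i -> exact i f -> (forall x, f (h x) = 0) ->
  exists g : {linear P -> K}, forall x, i (g x) = h x.
Proof.
by move=> i_inj exif fh; apply: factor_through_injective => // x; apply/exif.
Qed.

Lemma inj_surj_bijective (S T : Type) (f : S -> T) :
  injective f -> surjective f -> bijective f.
Proof. by move=> f_inj /choice[g gK]; exists g => // x; apply: f_inj. Qed.

Lemma linear_inverse M N (f : {linear M -> N}) :
  injective f -> surjective f ->
  exists g : {linear N -> M}, cancel f g /\ cancel g f.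
Proof.
move=> f_inj f_surj.
have [|g gP] := @factor_through_injective M N N f idfun f_inj.
  by move=> x; have [y] := f_surj x; exists y.
by exists g; split=> // x; apply: f_inj; rewrite gP.
Qed.

Definition isomorphic M N := exists f : {linear M -> N}, bijective f.

Lemma isomorphicP M N :
  isomorphic M N <->
  exists (f : {linear M -> N}) (g : {linear N -> M}), cancel f g /\ cancel g f.
Proof.
split=> [[f [g fK gK]]|[f [g [fK gK]]]]; last by exists f; exists g.
have [|g' g'P] := linear_inverse (can_inj fK); first by move=> y; exists (g y).
by exists f, g'.
Qed.

Lemma isomorphic_sym M N : isomorphic M N -> isomorphic N M.
Proof. by move=> /isomorphicP[f [g [fK gK]]]; exists g; exists f. Qed.

Lemma isomorphic_trans L M N :
  isomorphic L M -> isomorphic M N -> isomorphic L N.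
Proof. by case=> f fb [g gb]; exists (g \o f); apply: bij_comp. Qed.

Lemma isomorphic_prodC M N : isomorphic (M * N)%type (N * M)%type.
Proof.
have [|f fE] := @linear_of A (M * N)%type (N * M)%type (fun x => (x.2, x.1)).
  by move=> a [x x'] [y y'].
by exists f; exists (fun x => (x.2, x.1)) => -[x y]; rewrite fE.
Qed.

Lemma projective_prod P Q :
  projective P -> projective Q -> projective (P * Q)%type.
Proof.
move=> Pproj Qproj M N g f g_surj.
have [f1 f1E] : exists f1 : {linear P -> N}, f1 =1 fun x => f (x, 0).
  apply: linear_of => a x y; rewrite -linearP; congr (f _).
  by apply: pair_ext; rewrite /= ?scaler0 ?addr0.
have [f2 f2E] : exists f2 : {linear Q -> N}, f2 =1 fun x => f (0, x).
  apply: linear_of => a x y; rewrite -linearP; congr (f _).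
  by apply: pair_ext; rewrite /= ?scaler0 ?addr0.
have [h1 h1P] := Pproj _ _ g f1 g_surj.
have [h2 h2P] := Qproj _ _ g f2 g_surj.
have [h hE] : exists h : {linear (P * Q)%type -> M},
    h =1 fun x => h1 x.1 + h2 x.2.
  apply: linear_of => a [x x'] [y y'] /=.
  by rewrite !linearP scalerDr addrACA.
exists h => -[x y]; rewrite hE linearD /= h1P h2P f1E f2E -linearD.
by congr (f _); apply: pair_ext; rewrite /= ?addr0 ?add0r.
Qed.

Lemma projective_retract P Q (s : {linear P -> Q}) (r : {linear Q -> P}) :
  cancel s r -> projective Q -> projective P.
Proof.
move=> sK Qproj M N g f g_surj.
have [h hP] := Qproj _ _ g (f \o r) g_surj.
by exists (h \o s) => x; rewrite /= hP /= sK.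
Qed.

Lemma projective_isomorphic P Q :
  isomorphic P Q -> projective Q -> projective P.
Proof. by move=> /isomorphicP[f [g [fK _]]]; apply: projective_retract fK. Qed.

Lemma projective_row n : projective 'rV[A]_n.
Proof.
move=> M N g f g_surj.
have /choice[m mP] (j : 'I_n) : exists y, g y = f (delta_mx 0 j).
  exact: g_surj.
have [h hE] : exists h : {linear 'rV[A]_n -> M},
    h =1 fun v => \sum_j v 0 j *: m j.
  apply: linear_of => a u v; rewrite scaler_sumr -big_split /=.
  by apply: eq_bigr => j _; rewrite !mxE scalerDl scalerA.
exists h => v; rewrite hE [in RHS](row_sum_delta v) !linear_sum.
by apply: eq_bigr => j _; rewrite !linearZ /= mP.
Qed.

Lemma fin_gen_row n : fin_gen 'rV[A]_n.
Proof.
exists n, (fun j => delta_mx 0 j) => v.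
by exists (fun j => v 0 j); rewrite -row_sum_delta.
Qed.

Lemma fin_gen_free_cover M :
  fin_gen M -> exists n (p : {linear 'rV[A]_n -> M}), surjective p.
Proof.
case=> n [e eP]; exists n.
have [p pE] : exists p : {linear 'rV[A]_n -> M},
    p =1 fun v => \sum_j v 0 j *: e j.
  apply: linear_of => a u v; rewrite scaler_sumr -big_split /=.
  by apply: eq_bigr => j _; rewrite !mxE scalerDl scalerA.
exists p => x; have [c ->] := eP x; exists (\row_j c j).
by rewrite pE; apply: eq_bigr => j _; rewrite mxE.
Qed.

Lemma fin_gen_surjective M N (f : {linear M -> N}) :
  surjective f -> fin_gen M -> fin_gen N.
Proof.
move=> f_surj [n [e eP]]; exists n, (f \o e) => y.
have [x <-] := f_surj y; have [c ->] := eP x; exists c.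
by rewrite linear_sum; apply: eq_bigr => i _; rewrite linearZ.
Qed.

Lemma fin_gen_prod M N : fin_gen M -> fin_gen N -> fin_gen (M * N)%type.
Proof.
move=> /fin_gen_free_cover[m [p p_surj]] /fin_gen_free_cover[n [q q_surj]].
have [f fE] : exists f : {linear 'rV[A]_(m + n) -> (M * N)%type},
    f =1 fun v => (p (lsubmx v), q (rsubmx v)).
  by apply: linear_of => a u v; apply: pair_ext; rewrite /= !linearP.
apply: (@fin_gen_surjective _ _ f) (fin_gen_row _) => -[x y].
have [u <-] := p_surj x; have [v <-] := q_surj y.
by exists (row_mx u v); rewrite fE row_mxKl row_mxKr.
Qed.

Lemma noetherian_injective L M (i : {linear L -> M}) :
  injective i -> noetherian M -> noetherian L.
Proof.
move=> i_inj noethM S Ssub; apply: (fin_spanned_extension (f := i)) => //.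
  exact: noethM (submodule_image i Ssub).
apply: fin_spanned_zero => [|x [_ ix]]; first exact: submodule_meet_kernel.
by apply: i_inj; rewrite ix linear0.
Qed.

Lemma noetherian_fin_gen M : noetherian M -> fin_gen M.
Proof. by move=> noethM; apply/fin_genP; apply: noethM; split. Qed.

(** The kernels of the iterates of [g] have a finitely generated union, so
that one of them, that of [g^k], contains all the others; writing [x] with [g
x = 0] as [g^k y] gives [g^(k+1) y = 0], hence [g^k y = 0]. *)
Lemma noetherian_surjective_injective L (g : {linear L -> L}) :
  noetherian L -> surjective g -> injective g.
Proof.
move=> noethL g_surj.
have iterL n a x y : iter n g (a *: x + y) = a *: iter n g x + iter n g y.
  by elim: n => //= n ->; rewrite linearP.
have iter0 n : iter n g 0 = 0 by elim: n => //= n ->; rewrite linear0.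
have iter_mono n m x : (n <= m)%N -> iter n g x = 0 -> iter m g x = 0.
  by move=> /subnK <- gx; rewrite iterD gx iter0.
have [|s sP] := noethL (fun x => exists n, iter n g x = 0).
  split=> [|a x y [n gx] [m gy]]; first by exists 0.
  exists (maxn n m); rewrite iterL (iter_mono n) ?leq_maxl //.
  by rewrite (iter_mono m) ?leq_maxr // scaler0 addr0.
have [k kP] : exists k, forall y, y \in s -> iter k g y = 0.
  have : forall y, y \in s -> exists n, iter n g y = 0.
    by move=> y sy; apply/sP; apply: mem_span.
  elim: s {sP} => [|v s IHs] sP; first by exists 0.
  have [|k kP] := IHs; first by move=> y sy; apply: sP; rewrite inE sy orbT.
  have [n gv] := sP v (mem_head _ _).
  exists (maxn n k) => y; rewrite inE => /orP[/eqP->|/kP].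
    by apply: iter_mono gv; exact: leq_maxl.
  by apply: iter_mono; exact: leq_maxr.
suff g_ker x : g x = 0 -> x = 0.
  move=> x y gxy; apply/eqP; rewrite -subr_eq0; apply/eqP; apply: g_ker.
  by rewrite linearB gxy subrr.
have [y <-] : exists y, iter k g y = x.
  elim: k x {kP} => [|k IHk] x; first by exists x.
  have [x' <-] := g_surj x; have [y <-] := IHk x'.
  by exists y.
rewrite -iterS => gy.
have /sP/(_ (fun y => iter k g y = 0)) : exists n, iter n g y = 0.
  by exists k.+1.
by apply=> //; split=> // a u v gu gv; rewrite iterL gu gv scaler0 addr0.
Qed.

End LinearMaps.

(** Let [p : F -> M] be a surjection from a free module and [phi] an
endomorphism of [F] with [p phi = p] and minimal image [L]. Since [phi phi]
has the same property, [phi] maps [L] onto itself, hence bijectively, so that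
[phi] followed by the inverse of this bijection is a retraction of [F] onto
[L], and [L] is projective. The restriction of [p] to [L] is a cover: if [T]
is a submodule of [L] still mapping onto [M], then [p] lifts to a map [F ->
T], whose image must be all of [L] by minimality. *)
Lemma projective_cover_exists (A : pzRingType) (M : lmodType A) :
  artin_algebra A -> fin_gen M ->
  exists (P : lmodType A) (f : {linear P -> M}),
    fin_gen P /\ projective_cover f.
Proof.
move=> artA Mfg; have [n [p p_surj]] := fin_gen_free_cover Mfg.
have [noethF dccF] := artin_algebra_fin_gen artA (fin_gen_row A n).
have Fproj := @projective_row A n.
set F := ('rV[A]_n : lmodType A) in p p_surj noethF dccF Fproj *.
pose Q (S : F -> Prop) := exists2 phi : {linear F -> F},
  forall x, p (phi x) = p x & forall x, S x <-> exists y, phi y = x.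
have Qsub S : Q S -> submodule S.
  case=> phi _ SE; have [S0 SL] := submodule_range phi.
  split=> [|a x y /SE Sx /SE Sy]; first exact/SE.
  by apply/SE; apply: SL.
have [|S QS Smin] := dcc_minimal dccF Qsub.
  by exists (fun=> True), idfun => // x; split=> // _; exists x.
have Ssub := Qsub S QS; case: QS => phi pphi SE.
have [L [i [i_inj iP]]] := submodule_incl Ssub.
have [|phi' phi'E] := factor_through_injective (h := phi) i_inj.
  by move=> x; apply/iP/SE; exists x.
(* [phi' \o i] is the endomorphism of [L] induced by [phi]. *)
have g_surj : surjective (phi' \o i).
  move=> l.
  have [] := Smin (fun x => exists y, phi (phi y) = x) _ _ (i l).
  - by exists (phi \o phi) => //= x; rewrite !pphi.
  - by move=> x [y <-]; apply/SE; exists (phi y).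
  - by apply/iP; exists l.
  move=> y phiy; exists (phi' y); apply: i_inj.
  by rewrite /= !phi'E.
have noethL := noetherian_injective i_inj noethF.
have g_inj := noetherian_surjective_injective noethL g_surj.
have [g' [gK _]] := linear_inverse g_inj g_surj.
have Lproj : projective L.
  by apply: (projective_retract (s := i) (r := g' \o phi')) => // x; exact: gK.
exists L, (p \o i); split; first exact: noetherian_fin_gen.
split=> // [m|T TP x].
  by have [x <-] := p_surj m; exists (phi' x); rewrite /= phi'E pphi.
pose q : {linear carrier T -> M} := p \o i \o (\val : carrier T -> L).
have [|psi psiP] := Fproj _ _ q p.
  move=> m; have [y <-] := p_surj m.
  have [z Tz [w pw zw]] := TP (phi' y).
  exists (exist _ z Tz : carrier T); rewrite -[RHS]pphi -phi'E zw.
  by rewrite -[RHS]/((p \o i) (z + w)) linearD pw addr0.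
have [] := Smin (fun x => exists y, i (\val (psi y)) = x) _ _ (i x).
- by exists (i \o (\val : carrier T -> L) \o psi) => // y; exact: psiP.
- by move=> _ [y <-]; apply/iP; exists (\val (psi y)).
- by apply/iP; exists x.
by move=> y /i_inj <-; exact: valP.
Qed.

(** * Projective dimension and syzygies *)

Section Homological.
Variable A : pzRingType.
Implicit Types K L M N P Q W X Y Z : lmodType A.

(** With lifts [u] of [f] through [g] and [v] of [g] through [f], both modules
are coordinates on the pullback of [f] and [g]: [(x, q)] corresponds to [(i x
+ v q, q)], and [(p, y)] to [(p, u p + j y)]. *)
Lemma schanuel M P Q K L (f : {linear P -> M}) (g : {linear Q -> M})
    (i : {linear K -> P}) (j : {linear L -> Q}) :
  projective P -> projective Q -> surjective f -> surjective g ->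
  injective i -> exact i f -> injective j -> exact j g ->
  isomorphic (K * Q)%type (P * L)%type.
Proof.
move=> Pproj Qproj f_surj g_surj i_inj ex_if j_inj ex_jg.
have [u uP] := Pproj _ _ g f g_surj.
have [v vP] := Qproj _ _ f g f_surj.
have [a aE] : exists a : {linear (K * Q)%type -> P},
    a =1 fun z => i z.1 + v z.2.
  by apply: linear_of => c x y; rewrite /= !linearP scalerDr addrACA.
have [b bE] : exists b : {linear (P * L)%type -> Q},
    b =1 fun z => u z.1 + j z.2.
  by apply: linear_of => c x y; rewrite /= !linearP scalerDr addrACA.
have fi x : f (i x) = 0 by apply/ex_if; exists x.
have gj x : g (j x) = 0 by apply/ex_jg; exists x.
have [c cE] : exists c : {linear (K * Q)%type -> Q},
    c =1 fun z => z.2 - u (a z).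
  by apply: linear_of => r x y; rewrite /= !linearP /= scalerDr addrACA.
have [d dE] : exists d : {linear (P * L)%type -> P},
    d =1 fun z => z.1 - v (b z).
  by apply: linear_of => r x y; rewrite /= !linearP /= scalerDr addrACA.
have [|c' c'P] := factor_through_kernel (h := c) j_inj ex_jg.
  by move=> z; rewrite cE linearB uP aE linearD fi vP add0r subrr.
have [|d' d'P] := factor_through_kernel (h := d) i_inj ex_if.
  by move=> z; rewrite dE linearB vP bE linearD gj uP addr0 subrr.
have [h hE] : exists h : {linear (K * Q)%type -> (P * L)%type},
    h =1 fun z => (a z, c' z).
  by apply: linear_of => r x y; rewrite !linearP.
exists h; exists (fun z => (d' z, b z)) => z; rewrite hE.
  have bz : b (a z, c' z) = z.2 by rewrite bE /= c'P cE addrC subrK.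
  apply: pair_ext => //=; apply: i_inj.
  by rewrite d'P dE bz /= aE addrK.
have az : a (d' z, b z) = z.1 by rewrite aE /= d'P dE subrK.
apply: pair_ext => //=; apply: j_inj.
by rewrite c'P cE az /= bE addrC addKr.
Qed.

Lemma split_extension K M P (i : {linear K -> M}) (p : {linear M -> P}) :
  projective P -> injective i -> exact i p -> surjective p ->
  isomorphic (K * P)%type M.
Proof.
move=> Pproj i_inj ex_ip p_surj.
have [s sP] := Pproj _ _ p idfun p_surj.
have pi x : p (i x) = 0 by apply/ex_ip; exists x.
have [f fE] : exists f : {linear (K * P)%type -> M},
    f =1 fun z => i z.1 + s z.2.
  by apply: linear_of => c x y; rewrite /= !linearP scalerDr addrACA.
exists f; apply: inj_surj_bijective => [z w|h].
  rewrite !fE => eq_zw.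
  have eq2 : z.2 = w.2.
    by move/(congr1 p): eq_zw; rewrite !linearD !pi !sP !add0r.
  apply: pair_ext => //; apply: i_inj; move: eq_zw.
  by rewrite eq2 => /addIr.
have /ex_ip[k kE] : p (h - s (p h)) = 0 by rewrite linearB sP subrr.
by exists (k, p h); rewrite fE /= kE subrK.
Qed.

(** [pd M <= n], by recursion on syzygies for some choice of projective
surjections, not necessarily covers. *)
Fixpoint pd_le M n : Prop :=
  if n is n'.+1 then
    exists P (f : {linear P -> M}) K (i : {linear K -> P}),
      [/\ projective P, surjective f, injective i, exact i f & pd_le K n']
  else projective M.

Lemma pd_le_isomorphic M N n : isomorphic M N -> pd_le M n -> pd_le N n.
Proof.
case: n => [|n] isoMN.
  by apply: projective_isomorphic; apply: isomorphic_sym.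
case=> P [f [K [i [Pproj f_surj i_inj ex_if Kpd]]]].
have [t [t' [tK t'K]]] := iffLR (isomorphicP _ _) isoMN.
exists P, (t \o f), K, i; split=> // [y|x].
  by have [x fx] := f_surj (t' y); exists x; rewrite /= fx t'K.
rewrite -ex_if /=; split=> [tfx|->]; last exact: linear0.
by apply: (can_inj tK); rewrite tfx linear0.
Qed.

Lemma pd_le_prod_projective M P n :
  projective P -> pd_le M n -> pd_le (M * P)%type n.
Proof.
move=> Pproj; case: n => [|n] /=; first by move=> /projective_prod; apply.
case=> Q [f [K [i [Qproj f_surj i_inj ex_if Kpd]]]].
have [g gE] : exists g : {linear (Q * P)%type -> (M * P)%type},
    g =1 fun z => (f z.1, z.2).
  by apply: linear_of => c x y; apply: pair_ext; rewrite /= ?linearP.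
have [inl inlE] := linear_inl Q P.
pose j : {linear K -> (Q * P)%type} := inl \o i.
have jE x : j x = (i x, 0) by rewrite /= inlE.
exists (Q * P)%type, g, K, j; split=> //.
- exact: projective_prod.
- by move=> [m p]; have [q <-] := f_surj m; exists (q, p); rewrite gE.
- by move=> x y; rewrite !jE => -[/i_inj].
- move=> [q p]; rewrite gE; split=> [[/ex_if[x <-] ->]|[x]].
    by exists x; rewrite jE.
  rewrite jE => -[ix <-]; have -> : f q = 0 by apply/ex_if; exists x.
  by [].
Qed.

(** For a resolution of [M * P] starting with [f : Q -> M * P], the kernel of
the first component of [f] is an extension of [P] by the kernel of [f]; it
splits, so the previous lemma applies to it. *)
Lemma pd_le_of_prod_projective M P n :
  projective P -> pd_le (M * P)%type n -> pd_le M n.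
Proof.
move=> Pproj; pose fstL : {linear (M * P)%type -> M} := fst.
have [inl inlE] := linear_inl M P.
case: n => [|n] /=.
  by apply: (projective_retract (s := inl) (r := fstL)) => x; rewrite inlE.
case=> Q [f [K [i [Qproj f_surj i_inj ex_if Kpd]]]].
have [H [j [j_inj ex_j]]] := kernel (fstL \o f).
exists Q, (fstL \o f), H, j; split=> //.
  by move=> x; have [q fq] := f_surj (x, 0); exists q; rewrite /= fq.
have [|i' i'P] := factor_through_kernel (h := i) j_inj ex_j.
  by move=> x; rewrite /= (_ : f (i x) = 0) //; apply/ex_if; exists x.
pose sndL : {linear (M * P)%type -> P} := snd.
apply: pd_le_isomorphic (pd_le_prod_projective Pproj Kpd).
apply: (split_extension (i := i') (p := sndL \o f \o j)) => //.
- by move=> x y /(congr1 j); rewrite !i'P => /i_inj.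
- move=> x; split=> [fx2|[y <-]].
    have fj0 : f (j x) = 0.
      by apply: pair_ext => //; apply/(ex_j (j x)); exists x.
    have /ex_if[y yE] := fj0.
    by exists y; apply: j_inj; rewrite i'P.
  by rewrite /= i'P (_ : f (i y) = 0) //; apply/ex_if; exists y.
- move=> p; have [q fq] := f_surj (0, p).
  have /ex_j[x xE] : (fstL \o f) q = 0 by rewrite /= fq.
  by exists x; rewrite /= xE fq.
Qed.

(** Dimension shifting along an arbitrary surjection [f] from a projective
module: by Schanuel's lemma its kernel [W] is stably isomorphic to the syzygy
[K] of the given resolution. *)
Lemma pd_le_syzygy Y P W n (f : {linear P -> Y}) (i : {linear W -> P}) :
  projective P -> surjective f -> injective i -> exact i f ->
  pd_le Y n.+1 -> pd_le W n.
Proof.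
move=> Pproj f_surj i_inj ex_if [Q [g [K [j [Qproj g_surj j_inj ex_jg Kpd]]]]].
apply: (pd_le_of_prod_projective Qproj).
apply: (pd_le_isomorphic (M := (K * P)%type)).
  apply: isomorphic_trans (isomorphic_prodC _ _).
  exact: (schanuel (f := g) (g := f) (i := j) (j := i)).
exact: pd_le_prod_projective.
Qed.

Lemma has_proj_resolution_pd_le M n : has_proj_resolution M n -> pd_le M n.
Proof.
elim: n M => [|n IHn] M [P [d [e [Pproj e_surj ex_de ex_d P0]]]] /=.
  have e_inj : injective e.
    move=> x y exy; apply/eqP; rewrite -subr_eq0; apply/eqP.
    have /ex_de[z <-] : e (x - y) = 0 by rewrite linearB exy subrr.
    by rewrite (P0 1 isT z) linear0.
  have [e' [eK e'K]] := linear_inverse e_inj e_surj.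
  apply: (projective_isomorphic _ (Pproj 0)).
  by exists e'; exists e.
have [K [i [i_inj ex_ie]]] := kernel e.
exists (P 0), e, K, i; split=> //; apply: IHn.
have [|d0 d0P] := factor_through_kernel (h := d 0) i_inj ex_ie.
  by move=> x; apply/ex_de; exists x.
exists (fun m => P m.+1), (fun m => d m.+1), d0; split=> //.
- move=> x; have /ex_de[y yE] : e (i x) = 0 by apply/ex_ie; exists x.
  by exists y; apply: i_inj; rewrite d0P.
- move=> x; rewrite -(ex_d 0); split=> [dx|dx].
    by rewrite -d0P dx linear0.
  by apply: i_inj; rewrite d0P dx linear0.
- by move=> m lt_nm; apply: P0.
Qed.

(** [is_Omega_iter] grows at the end, while the induction in
[Omega_iter_summand] takes off the first syzygy. *)
Lemma is_Omega_iter_Omega M K L n :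
  is_Omega M K -> is_Omega_iter K n L -> is_Omega_iter M n.+1 L.
Proof.
move=> MK; elim=> [|d L1 L2 _ IH L1L2]; last exact: is_Omega_iterS L1L2.
by apply: is_Omega_iterS MK; exact: is_Omega_iter0.
Qed.

(** The middle map is [h (p, q) = a (f p) + g' q] for a lift [g'] of [g] through
[b]. *)
Lemma horseshoe X Y Z P Q K L (a : {linear X -> Y}) (b : {linear Y -> Z})
    (f : {linear P -> X}) (g : {linear Q -> Z})
    (i : {linear K -> P}) (j : {linear L -> Q}) :
  injective a -> exact a b -> surjective b ->
  surjective f -> injective i -> exact i f ->
  projective Q -> surjective g -> injective j -> exact j g ->
  exists (W : lmodType A) (h : {linear (P * Q)%type -> Y})
    (l : {linear W -> (P * Q)%type})
    (u : {linear K -> W}) (v : {linear W -> L}),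
    [/\ surjective h, injective l, exact l h &
        [/\ injective u, exact u v & surjective v]].
Proof.
move=> a_inj ex_ab b_surj f_surj i_inj ex_if Qproj g_surj j_inj ex_jg.
have [g' g'P] := Qproj _ _ b g b_surj.
have [h hE] : exists h : {linear (P * Q)%type -> Y},
    h =1 fun z => a (f z.1) + g' z.2.
  by apply: linear_of => c x y; rewrite /= !linearP scalerDr addrACA.
have ba x : b (a x) = 0 by apply/ex_ab; exists x.
have fi x : f (i x) = 0 by apply/ex_if; exists x.
have gj x : g (j x) = 0 by apply/ex_jg; exists x.
have [W [l [l_inj ex_lh]]] := kernel h.
have hl w : h (l w) = 0 by apply/ex_lh; exists w.
have [inl inlE] := linear_inl P Q.
pose i1 : {linear K -> (P * Q)%type} := inl \o i.
have i1E x : i1 x = (i x, 0) by rewrite /= inlE.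
have [|u uP] := factor_through_kernel (h := i1) l_inj ex_lh.
  by move=> x; rewrite i1E hE /= fi !linear0 addr0.
pose sndL : {linear (P * Q)%type -> Q} := snd.
have [|v vP] := factor_through_kernel (h := sndL \o l) j_inj ex_jg.
  by move=> w; have := congr1 b (hl w); rewrite hE linearD ba g'P add0r linear0.
exists W, h, l, u, v; split=> //; last split.
- move=> y; have [q gq] := g_surj (b y).
  have /ex_ab[x ax] : b (y - g' q) = 0 by rewrite linearB g'P gq subrr.
  by have [p fp] := f_surj x; exists (p, q); rewrite hE /= fp ax subrK.
- by move=> x y /(congr1 l); rewrite !uP !i1E => -[/i_inj].
- move=> w; split=> [vw|[x <-]]; last first.
    by apply: j_inj; rewrite vP /= uP i1E linear0.
  have lw2 : (l w).2 = 0 by rewrite -[LHS]/((sndL \o l) w) -vP vw linear0.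
  have /ex_if[x ix] : f (l w).1 = 0.
    by apply: a_inj; have := hl w; rewrite hE lw2 !linear0 addr0.
  by exists x; apply: l_inj; rewrite uP i1E; apply: pair_ext.
- move=> z.
  have /ex_ab[x ax] : b (g' (j z)) = 0 by rewrite g'P gj.
  have [p fp] := f_surj x.
  have /ex_lh[w lw] : h (- p, j z) = 0 by rewrite hE /= !linearN fp ax addNr.
  by exists w; apply: j_inj; rewrite vP /= lw.
Qed.

Lemma Omega_exists M :
  artin_algebra A -> fin_gen M ->
  exists P K (f : {linear P -> M}) (i : {linear K -> P}),
    [/\ fin_gen P, fin_gen K, projective_cover f, injective i & exact i f].
Proof.
move=> artA Mfg; have [P [f [Pfg f_cover]]] := projective_cover_exists artA Mfg.
have [K [i [i_inj ex_if]]] := kernel f.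
exists P, K, f, i; split=> //; apply: noetherian_fin_gen.
by apply: noetherian_injective i_inj _; case: (artin_algebra_fin_gen artA Pfg).
Qed.

(** Each step replaces the sequence by that of the kernels of the horseshoe; the
projective dimension of the middle term drops by one, until that term is
projective and Schanuel's lemma concludes. *)
Lemma Omega_iter_summand n X Y Z (a : {linear X -> Y}) (b : {linear Y -> Z}) :
  artin_algebra A -> fin_gen X -> fin_gen Y -> fin_gen Z ->
  injective a -> exact a b -> surjective b -> pd_le Y n ->
  exists K P L,
    [/\ is_Omega_iter X n K, fin_gen P /\ projective P,
        is_Omega_iter Z n.+1 L & direct_summand K (P * L)%type].
Proof.
move=> artA; elim: n X Y Z a b => [|n IHn] X Y Z a b Xfg Yfg Zfg a_inj ex_ab
    b_surj Ypd;
  have [Q [L [g [j [Qfg Lfg g_cover j_inj ex_jg]]]]] := Omega_exists artA Zfg;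
  have [Qproj g_surj _] := g_cover;
  have OL : is_Omega Z L by exists Q, g, j.
  exists X, Y, L; split=> //; first exact: is_Omega_iter0.
    by apply: is_Omega_iterS OL; exact: is_Omega_iter0.
  by exists Q; apply: (schanuel (f := b) (g := g) (i := a) (j := j)).
have [P [K [f [i [Pfg Kfg f_cover i_inj ex_if]]]]] := Omega_exists artA Xfg.
have [Pproj f_surj _] := f_cover.
have OK : is_Omega X K by exists P, f, i.
have [W [h [l [u [v [h_surj l_inj ex_lh [u_inj ex_uv v_surj]]]]]]] :=
  horseshoe a_inj ex_ab b_surj f_surj i_inj ex_if Qproj g_surj j_inj ex_jg.
have Wpd := pd_le_syzygy (projective_prod Pproj Qproj) h_surj l_inj ex_lh Ypd.
have Wfg : fin_gen W.
  apply: noetherian_fin_gen; apply: noetherian_injective l_inj _.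
  by have [] := artin_algebra_fin_gen artA (fin_gen_prod Pfg Qfg).
have [K' [P' [L' [KK' P'P LL' sum]]]] :=
  IHn K W L u v Kfg Wfg Lfg u_inj ex_uv v_surj Wpd.
exists K', P', L'; split=> //; first exact: is_Omega_iter_Omega OK KK'.
exact: is_Omega_iter_Omega OL LL'.
Qed.

End Homological.

Lemma least_le (Q Q' : nat -> Prop) :
  (forall n, Q' n -> Q n) -> (least Q <= least Q')%E.
Proof.
move=> Q'Q; rewrite /least; case: pselect => [ex|nex];
  case: pselect => [ex'|_]; rewrite ?leey //.
  rewrite lee_fin lez_nat; case: ex_minnP => m _; apply.
  by case: ex_minnP => n /asboolP/Q'Q Qn _; exact/asboolP.
by case: nex; case: ex' => n /asboolP/Q'Q Qn; exists n; apply/asboolP.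
Qed.

Theorem proposition2p3 (A : pzRingType) (hA : artin_algebra A)
    (Y : lmodType A) (hY : fin_gen Y)
    (X : lmodType A) (i : {linear X -> Y}) (hi : injective i) :
  (del X <= pd Y)%E.
Proof.
apply: least_le => n /has_proj_resolution_pd_le Ypd.
have [noethY _] := artin_algebra_fin_gen hA hY.
have [Z [p [p_surj ker_p]]] : exists (Z : lmodType A) (p : {linear Y -> Z}),
    surjective p /\ exact i p.
  exact: cokernel (submodule_range i).
have Xfg := noetherian_fin_gen (noetherian_injective hi noethY).
have Zfg := fin_gen_surjective p_surj hY.
have [K [P [L [XK PP ZL sum]]]] :=
  Omega_iter_summand hA Xfg hY Zfg hi ker_p p_surj Ypd.
by exists K, P, Z, L.
Qed.
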